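(* Let $F:\mathbb{R}^n\to\mathbb{R}^n$ be given in abs-normal form $z=c+Zx+L|z|$, $F(x)=b+Jx+Y|z|$ with $\det J\neq0$, and let $S=L-ZJ^{-1}Y$. If in some $p$-norm $$\|S-L\|_p+\|L\|_p<1,$$ then the Block Seidel iteration $z^+=z(x(z))$ converges from every $z_0\in\mathbb{R}^s$ to its unique fixed point $z_*$. Moreover, the corresponding point $x_*=-J^{-1}(b+Y|z_*|)$ is the unique root of $F(x)=0$.
   Context: Here $c\in\mathbb{R}^s$, $b\in\mathbb{R}^n$, $Z\in\mathbb{R}^{s\times n}$, $L\in\mathbb{R}^{s\times s}$ strictly lower triangular, $J\in\mathbb{R}^{n\times n}$, $Y\in\mathbb{R}^{n\times s}$, and $|\cdot|$ acts componentwise; $F(x)=b+Jx+Y|z|$ where $z$ is the unique solution of $z=c+Zx+L|z|$. Define $x(z)=-J^{-1}(b+Y|z|)$ for $z\in\mathbb{R}^s$, $G(z)=z-L|z|$ (a bijection of $\mathbb{R}^s$ since $L$ is strictly lower triangular), and $z(x)=G^{-1}(c+Zx)$ for $x\in\mathbb{R}^n$. Matrix norms $\|\cdot\|_p$ are the operator norms induced by the vector $p$-norms, $1\le p\le\infty$. *)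

(* Defs.v *)
From HB Require Import structures.
From mathcomp Require Import all_boot all_order all_algebra.
From mathcomp Require Import all_classical all_reals all_analysis.
Set Implicit Arguments.
Unset Strict Implicit.
Unset Printing Implicit Defensive.
Import Order.TTheory GRing.Theory Num.Theory.
Import numFieldNormedType.Exports.
Local Open Scope classical_set_scope.
Local Open Scope ring_scope.

Definition absv (R : realType) (s : nat) (z : 'cV[R]_s) : 'cV[R]_s :=
  map_mx Num.norm z.

Definition strictly_lower_triangular (R : realType) (s : nat)
    (L : 'M[R]_s) : Prop :=
  forall i j : 'I_s, (i <= j)%N -> L i j = 0.

(* Only meant for 1 <= p <= +oo; the value at -oo is junk. *)
Definition pnorm (R : realType) (p : \bar R) (n : nat) (x : 'cV[R]_n) : R :=
  match p with
  | r%:E => (\sum_(i < n) `|x i 0| `^ r) `^ r^-1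
  | +oo%E => \big[Num.max/0]_(i < n) `|x i 0|
  | -oo%E => 0
  end.

(* The closed unit ball, rather than the unit sphere, keeps the set non-empty
   in dimension 0. *)
Definition opnorm (R : realType) (p : \bar R) (m n : nat)
    (A : 'M[R]_(m, n)) : R :=
  sup [set pnorm p (A *m x) | x in [set x : 'cV[R]_n | pnorm p x <= 1]].

Definition Gmap (R : realType) (s : nat) (L : 'M[R]_s) (z : 'cV[R]_s) :
    'cV[R]_s :=
  z - L *m absv z.

(* The genuine two-sided inverse when L is strictly lower triangular, by
   Gmap_bij below. *)
Definition Ginv (R : realType) (s : nat) (L : 'M[R]_s) :
    'cV[R]_s -> 'cV[R]_s :=
  'pinv_(fun=> 0) [set: 'cV[R]_s] (Gmap L).

Definition z_of_x (R : realType) (n s : nat) (c : 'cV[R]_s)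
    (Z : 'M[R]_(s, n)) (L : 'M[R]_s) (x : 'cV[R]_n) : 'cV[R]_s :=
  Ginv L (c + Z *m x).

Definition x_of_z (R : realType) (n s : nat) (b : 'cV[R]_n)
    (J : 'M[R]_n) (Y : 'M[R]_(n, s)) (z : 'cV[R]_s) : 'cV[R]_n :=
  - (invmx J *m (b + Y *m absv z)).

Definition abs_normal (R : realType) (n s : nat) (c : 'cV[R]_s)
    (b : 'cV[R]_n) (Z : 'M[R]_(s, n)) (L : 'M[R]_s) (J : 'M[R]_n)
    (Y : 'M[R]_(n, s)) (x : 'cV[R]_n) : 'cV[R]_n :=
  b + J *m x + Y *m absv (z_of_x c Z L x).

Definition block_seidel (R : realType) (n s : nat) (c : 'cV[R]_s)
    (b : 'cV[R]_n) (Z : 'M[R]_(s, n)) (L : 'M[R]_s) (J : 'M[R]_n)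
    (Y : 'M[R]_(n, s)) (z : 'cV[R]_s) : 'cV[R]_s :=
  z_of_x c Z L (x_of_z b J Y z).

Lemma mulmx_slt (R : realType) (s : nat) (L : 'M[R]_s) (u v : 'cV[R]_s)
    (i : 'I_s) : strictly_lower_triangular L ->
  (forall j : 'I_s, (j < i)%N -> u j 0 = v j 0) ->
  (L *m absv u) i 0 = (L *m absv v) i 0.
Proof.
move=> hL huv; rewrite !mxE; apply: eq_bigr => j _; rewrite !mxE.
by case: (ltnP j i) => [ji|ij]; [rewrite huv | rewrite hL // !mul0r].
Qed.

Lemma Gmap_inj (R : realType) (s : nat) (L : 'M[R]_s) :
  strictly_lower_triangular L -> injective (Gmap L).
Proof.
move=> hL u v huv.
suff H k (i : 'I_s) : (i < k)%N -> u i 0 = v i 0.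
  by apply/colP => i; apply: (H s).
elim: k i => // k IH i ik.
have /colP/(_ i) := huv; rewrite /Gmap 2!mxE [RHS]mxE [X in _ = _ + X]mxE.
rewrite (@mulmx_slt _ _ L u v) //; first exact: addIr.
by move=> j ji; apply: IH; apply: leq_trans ji _.
Qed.

Lemma Gmap_surj (R : realType) (s : nat) (L : 'M[R]_s) (w : 'cV[R]_s) :
  strictly_lower_triangular L -> exists z, Gmap L z = w.
Proof.
move=> hL; pose u k := iter k (fun z => w + L *m absv z) 0.
have H k (i : 'I_s) : (i < k)%N -> u k.+1 i 0 = u k i 0.
  elim: k i => // k IH i ik.
  have uS j : u j.+1 = w + L *m absv (u j) by [].
  rewrite (uS k.+1) (uS k) mxE [RHS]mxE; congr (_ + _).
  apply: mulmx_slt => // j ji; apply: IH; exact: leq_trans ji _.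
exists (u s); rewrite /Gmap; apply/eqP; rewrite subr_eq; apply/eqP/colP => i.
by rewrite -[in LHS](H s) /=.
Qed.

Lemma Gmap_bij (R : realType) (s : nat) (L : 'M[R]_s) :
  strictly_lower_triangular L -> cancel (Gmap L) (Ginv L) /\
                                 cancel (Ginv L) (Gmap L).
Proof.
move=> hL; split => z.
  by apply: pinvKV; rewrite ?inE // => u v _ _; apply: Gmap_inj.
by apply: pinvK; rewrite inE; have [u <-] := Gmap_surj z hL; exists u.
Qed.

Lemma z_of_x_unique (R : realType) (n s : nat) (c : 'cV[R]_s)
    (Z : 'M[R]_(s, n)) (L : 'M[R]_s) (x : 'cV[R]_n) (z : 'cV[R]_s) :
  strictly_lower_triangular L ->
  z = c + Z *m x + L *m absv z <-> z = z_of_x c Z L x.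
Proof.
move=> /Gmap_bij[GK KG]; split => [zE|->].
  rewrite -[LHS]GK /z_of_x; congr Ginv.
  by rewrite /Gmap {1}zE addrK.
by apply/eqP; rewrite -subr_eq; apply/eqP/KG.
Qed.

(* Main.v *)
Require Import Defs.
From HB Require Import structures.
From mathcomp Require Import all_boot all_order all_algebra.
From mathcomp Require Import all_classical all_reals all_analysis.
Import Order.TTheory GRing.Theory Num.Theory.
Import numFieldNormedType.Exports.
Local Open Scope classical_set_scope.
Local Open Scope ring_scope.

(** Why the iteration converges. Write T for the Block Seidel map and
    M = S - L = - Z J^-1 Y. Eliminating x from the switching equation shows that
    T z is characterised implicitly by
      T z = (c - Z J^-1 b) + M |z| + L |T z|.
    The absolute value is nonexpansive componentwise, hence in every p-norm
    because these norms are monotone in the moduli of the entries. Subtracting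
    two instances of the equation therefore gives
      ||T u - T v|| <= ||M|| ||u - v|| + ||L|| ||T u - T v||,
    that is, T is Lipschitz with constant ||M|| / (1 - ||L||), which is smaller
    than 1 exactly when ||M|| + ||L|| < 1 (block_seidel_contraction).

    The contraction is measured in the p-norm whereas the topology of column
    vectors comes from the max-norm, for which T need not contract. The two
    norms are equivalent, with max-norm <= p-norm <= dimension * max-norm, and a
    fixed point principle for maps that contract an equivalent norm
    (equiv_norm_contraction) closes the gap: it yields the unique fixed point
    and the convergence of every orbit.

    Roots of F are then fixed points of T in disguise: as J is invertible,
    F(x) = 0 says x = x(z(x)) (abs_normal_eq0), so z(x) is a fixed point of
    T = z o x, hence equal to zs, and x = x(zs).

    What remains is to know that pnorm really is a norm. The triangle inequality
    for finite exponents comes from the convexity of the unit ball, itself a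
    consequence of the convexity of t |-> t^r on the nonnegative reals. *)

(** * Contractions for an equivalent norm *)

(** Matrices of any size are both complete and normed; declaring the completeness
    on the matrix type once more is what makes the combination of the two
    inferable as a completeNormedModType. *)
HB.instance Definition _ (R : realType) (m n : nat) :=
  Complete.copy 'M[R]_(m, n) 'M[R]_(m, n).

(** Successive increments of an orbit are bounded by N (f z - z) times powers of
    q, first for N and hence for the native norm, so the telescoping series of
    the orbit converges absolutely. For the native norm f is only
    Lipschitz with constant q C, possibly larger than 1, but the resulting
    continuity suffices to identify the limit as a fixed point. *)
Lemma equiv_norm_contraction {R : realType} {V : completeNormedModType R}
    [N : V -> R] [C q : R] [f : V -> V] :
  (forall x, `|x| <= N x) -> (forall x, N x <= C * `|x|) ->
  0 <= q < 1 -> (forall x y, N (f x - f y) <= q * N (x - y)) ->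
  exists l, [/\ f l = l, forall z, f z = z -> z = l &
    forall z, (fun k : nat => iter k f z) @ \oo --> l].
Proof.
move=> leN geN /andP[q0 q1] ctr.
have fix_uniq x y : f x = x -> f y = y -> x = y.
  move=> fx fy; apply/eqP; rewrite -subr_eq0 -normr_le0.
  apply: le_trans (leN _) _; rewrite leNgt; apply/negP => Ngt0.
  by have := ctr x y; rewrite fx fy; apply/negP; rewrite -ltNge gtr_pMl.
have orbit_cvg z : exists2 l, f l = l & (fun k : nat => iter k f z) @ \oo --> l.
  pose u k := iter k f z.
  have uS k : N (u k.+1 - u k) <= q ^+ k * N (f z - z).
    elim: k => [|k IH]; first by rewrite expr0 mul1r.
    by apply: le_trans (ctr _ _) _; rewrite exprS -mulrA ler_wpM2l.
  have cvgu : cvgn u.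
    have -> : u = (fun k => u 0%N + series (telescope u) k).
      by apply/funext => k; exact: eq_sum_telescope.
    apply: is_cvgD; first exact: is_cvg_cst.
    apply: normed_cvg.
    apply: (@series_le_cvg _ _ (geometric (N (f z - z)) q)) => [k|k|k|].
    - exact: normr_ge0.
    - rewrite /geometric/= mulr_ge0 ?exprn_ge0//.
      by apply: le_trans (leN _); exact: normr_ge0.
    - by rewrite /geometric/= mulrC; apply: le_trans (leN _) (uS k).
    - by apply: is_cvg_geometric_series; rewrite ger0_norm.
  pose l := limn u; have ul : u k @[k --> \oo] --> l by [].
  exists l => //.
  have fl : u k.+1 @[k --> \oo] --> f l.
    apply: cvg_zero; apply/norm_cvg0P.
    apply: (@squeeze_cvgr _ _ _ _ (cst 0) (fun k => q * C * `|u k - l|)).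
    - near=> k; rewrite normr_ge0/=; apply: le_trans (leN _) _.
      by apply: le_trans (ctr _ _) _; rewrite -mulrA ler_wpM2l.
    - exact: cvg_cst.
    - rewrite -(mulr0 (q * C)); apply: cvgMl_tmp; apply/norm_cvg0P.
      by rewrite -(subrr l); apply: cvgB => //; exact: cvg_cst.
  have ul' : u k.+1 @[k --> \oo] --> l by rewrite (cvg_shiftS u).
  exact: cvg_unique fl ul'.
(* Any orbit produces the fixed point; uniqueness makes all limits agree. *)
have [l fl _] := orbit_cvg 0.
exists l; split=> // [z fz|z]; first exact: fix_uniq.
by have [l' fl'] := orbit_cvg z; rewrite (fix_uniq l l').
Unshelve. all: by end_near. Qed.

(** * The p-norms *)

(** The case analysis behind the two branches, finite exponent and maximum, of
    the definition of pnorm. *)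
Lemma ereal_ge1_ind (R : realType) (P : \bar R -> Prop) :
  (forall r, 1 <= r -> P r%:E) -> P +oo%E -> forall p, (1 <= p)%E -> P p.
Proof. by move=> Pr Py [r /Pr| |]. Qed.

Section PNorm.
Context {R : realType} {p : \bar R}.
Hypothesis p_ge1 : (1 <= p)%E.

Lemma pnorm_ge0 {n} (x : 'cV[R]_n) : 0 <= pnorm p x.
Proof.
elim/ereal_ge1_ind: p / p_ge1 => [r _|]; first exact: powR_ge0.
exact: bigmax_ge_id.
Qed.

Lemma ler_pnorm {n} (x y : 'cV[R]_n) :
  (forall i, `|x i 0| <= `|y i 0|) -> pnorm p x <= pnorm p y.
Proof.
move=> xy; elim/ereal_ge1_ind: p / p_ge1 => [r r1|] /=; last first.
  by apply: le_bigmax2 => i _; exact: xy.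
have r0 : 0 <= r by exact: le_trans r1.
rewrite ge0_ler_powR ?invr_ge0 ?nnegrE ?sumr_ge0//.
by apply: ler_sum => i _; rewrite ge0_ler_powR ?nnegrE.
Qed.

Lemma pnormZ {n} (a : R) (x : 'cV[R]_n) : pnorm p (a *: x) = `|a| * pnorm p x.
Proof.
elim/ereal_ge1_ind: p / p_ge1 => [r r1|] /=; last first.
  under eq_bigr do rewrite mxE normrM.
  elim/big_rec2: _ => [|i u v _ ->]; first by rewrite mulr0.
  by rewrite maxr_pMr.
have r0 : r != 0 by rewrite gt_eqF// (lt_le_trans _ r1).
under eq_bigr do rewrite mxE normrM powRM//.
rewrite -mulr_sumr powRM ?powR_ge0 ?sumr_ge0//.
by rewrite -powRrM mulfV// powRr1.
Qed.

Lemma coord_le_pnorm {n} (x : 'cV[R]_n) i : `|x i 0| <= pnorm p x.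
Proof.
elim/ereal_ge1_ind: p / p_ge1 => [r r1|] /=; last first.
  exact: (le_bigmax _ (fun i => `|x i 0|)).
have r0 : 0 < r by rewrite (lt_le_trans _ r1).
rewrite -[leLHS]powRr1// -[X in _ `^ X](mulfV (lt0r_neq0 r0)) powRrM.
rewrite ge0_ler_powR ?invr_ge0 ?(ltW r0)// ?nnegrE ?powR_ge0 ?sumr_ge0//.
by rewrite (bigD1 i)//= lerDl sumr_ge0.
Qed.

Lemma pnorm_eq0 {n} {x : 'cV[R]_n} : pnorm p x = 0 -> x = 0.
Proof.
move=> x0; apply/colP => i; apply/eqP; rewrite mxE -normr_le0 -x0.
exact: coord_le_pnorm.
Qed.

Lemma pnorm0 {n} : pnorm p (0 : 'cV[R]_n) = 0.
Proof. by rewrite -(scale0r 0) pnormZ normr0 mul0r. Qed.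

Lemma pnorm_delta {n} (i : 'I_n) : pnorm p (delta_mx i 0 : 'cV[R]_n) <= 1.
Proof.
elim/ereal_ge1_ind: p / p_ge1 => [r r1|] /=; last first.
  by apply: bigmax_le => // j _; rewrite mxE; case: (_ && _);
    rewrite ?normr1 ?normr0.
have r0 : 0 < r by rewrite (lt_le_trans _ r1).
rewrite (bigD1 i)//= big1 => [|j ji].
  by rewrite mxE !eqxx normr1 addr0 !powR1.
by rewrite mxE (negbTE ji) normr0 powR0// gt_eqF.
Qed.

(** For a finite exponent r, the unit ball is also the sublevel set at 1 of the sum
    of the |v_i|^r, which is a sum of convex functions of v. Passing to this sum
    removes the outer root, which is concave. *)
Lemma convex_pnorm_ball {n} (t : R) (x y : 'cV[R]_n) : 0 <= t -> t <= 1 ->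
  pnorm p x <= 1 -> pnorm p y <= 1 -> pnorm p (t *: x + (1 - t) *: y) <= 1.
Proof.
move=> t0 t1; have t1' : 0 <= 1 - t by rewrite subr_ge0.
have ler_conv (a b : R) : a <= 1 -> b <= 1 -> t * a + (1 - t) * b <= 1.
  move=> a1 b1; rewrite -[leRHS](subrKC t 1) -[X in _ <= X + _]mulr1.
  by rewrite -[X in _ <= _ + X]mulr1 lerD ?ler_wpM2l.
have norm_conv i : `|(t *: x + (1 - t) *: y) i 0| <=
    t * `|x i 0| + (1 - t) * `|y i 0|.
  by rewrite !mxE (le_trans (ler_normD _ _))//
    !normrM (ger0_norm t0) (ger0_norm t1').
elim/ereal_ge1_ind: p / p_ge1 => [r r1|] /=; last first.
  move=> x1 y1; apply: bigmax_le => // i _.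
  apply: le_trans (norm_conv i) _; apply: ler_conv.
  - by apply: le_trans x1; exact: (le_bigmax _ (fun i => `|x i 0|)).
  - by apply: le_trans y1; exact: (le_bigmax _ (fun i => `|y i 0|)).
have r0 : 0 < r by rewrite (lt_le_trans _ r1).
have S0 (v : 'cV[R]_n) : 0 <= \sum_i `|v i 0| `^ r.
  by apply: sumr_ge0 => i _; exact: powR_ge0.
have one (z : R) : 1 `^ z = 1 by rewrite powR1.
have S1 (v : 'cV[R]_n) : (\sum_i `|v i 0| `^ r) `^ r^-1 <= 1 <->
    \sum_i `|v i 0| `^ r <= 1.
  split=> v1.
    rewrite -[leLHS]powRr1// -[X in _ `^ X](mulVf (lt0r_neq0 r0)) powRrM.
    rewrite -[leRHS](one r).
    by rewrite ge0_ler_powR ?(ltW r0)// nnegrE ?powR_ge0.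
  rewrite -[leRHS](one r^-1).
  by rewrite ge0_ler_powR ?invr_ge0 ?(ltW r0)// nnegrE.
move=> /S1 x1 /S1 y1; apply/S1; apply: le_trans (ler_conv _ _ x1 y1).
rewrite !mulr_sumr -big_split/=; apply: ler_sum => i _.
apply: (@le_trans _ _ ((t * `|x i 0| + (1 - t) * `|y i 0|) `^ r)).
  by rewrite ge0_ler_powR ?(ltW r0)// nnegrE// addr_ge0// mulr_ge0.
by apply: (convex_powR r1 (Itv01 t0 t1)); rewrite inE/= in_itv/= andbT.
Qed.

(** Minkowski's inequality: a nonnegative, definite and absolutely homogeneous
    gauge with convex unit ball is subadditive, because (x + y) / (a + b) is the
    convex combination of the unit vectors x / a and y / b with weights
    a / (a + b) and b / (a + b), where a and b are the norms of x and y. *)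
Lemma ler_pnormD {n} (x y : 'cV[R]_n) :
  pnorm p (x + y) <= pnorm p x + pnorm p y.
Proof.
have [/pnorm_eq0 ->|x0] := eqVneq (pnorm p x) 0; first by rewrite add0r pnorm0 add0r.
have [/pnorm_eq0 ->|y0] := eqVneq (pnorm p y) 0; first by rewrite addr0 pnorm0 addr0.
set a := pnorm p x in x0 *; set b := pnorm p y in y0 *.
have a0 : 0 < a by rewrite lt0r x0 pnorm_ge0.
have b0 : 0 < b by rewrite lt0r y0 pnorm_ge0.
have ab0 : 0 < a + b by rewrite addr_gt0.
have unit_norm (v : 'cV[R]_n) : 0 < pnorm p v -> pnorm p ((pnorm p v)^-1 *: v) <= 1.
  by move=> v0; rewrite pnormZ gtr0_norm ?invr_gt0// mulVf// gt_eqF.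
have -> : x + y = (a + b) *: (a / (a + b) *: (a^-1 *: x) +
                              (1 - a / (a + b)) *: (b^-1 *: y)).
  have -> : 1 - a / (a + b) = b / (a + b).
    by rewrite -[X in X - _](mulfV (lt0r_neq0 ab0)) -mulrBl addrC addKr.
  rewrite scalerDr !scalerA; congr (_ + _).
    by rewrite [in RHS]mulrCA mulfV ?gt_eqF// mulr1 mulfV// scale1r.
  by rewrite [in RHS]mulrCA mulfV ?gt_eqF// mulr1 mulfV// scale1r.
rewrite pnormZ gtr0_norm// -[leRHS]mulr1 ler_wpM2l ?(ltW ab0)//.
apply: convex_pnorm_ball; rewrite ?unit_norm//.
- by rewrite divr_ge0 ?ltW.
- by rewrite ler_pdivrMr// mul1r lerDl ltW.
Qed.

(** A bound independent of p, by the triangle inequality on the expansion in the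
    canonical basis, whose vectors have norm at most 1. *)
Lemma pnorm_le_sum {n} (x : 'cV[R]_n) : pnorm p x <= \sum_i `|x i 0|.
Proof.
have {1}-> : x = \sum_i x i 0 *: delta_mx i 0.
  by rewrite {1}[x]matrix_sum_delta; apply: eq_bigr => i _; rewrite big_ord1.
apply: (big_ind2 (fun (u : 'cV[R]_n) (s : R) => pnorm p u <= s)).
- by rewrite pnorm0.
- by move=> u s v t us vt; apply: le_trans (ler_pnormD _ _) _; exact: lerD.
- by move=> i _; rewrite pnormZ ler_piMr// pnorm_delta.
Qed.

(** The norm `|x| of a matrix is its max-norm; this lemma and the next one
    compare pnorm with it. *)
Lemma mx_norm_le_pnorm {n} (x : 'cV[R]_n) : `|x| <= pnorm p x.
Proof.
rewrite [leLHS]/Num.norm/= mx_normrE; apply: bigmax_le; first exact: pnorm_ge0.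
by move=> [i j] _; rewrite /= ord1 coord_le_pnorm.
Qed.

Lemma pnorm_le_mx_norm {n} (x : 'cV[R]_n) : pnorm p x <= n%:R * `|x|.
Proof.
apply: le_trans (pnorm_le_sum x) _.
rewrite mulr_natl -[X in _ *+ X]card_ord -sumr_const; apply: ler_sum => i _.
rewrite [leRHS]/Num.norm/= mx_normrE.
exact: (le_bigmax _ (fun ij => `|x ij.1 ij.2|) (i, 0)).
Qed.

(** * Operator norms *)

(** Without this bound the supremum defining opnorm could be the default value
    that sup takes on unbounded sets. *)
Lemma pnorm_mulmx_bounded {m n} (A : 'M[R]_(m, n)) :
  has_ubound [set pnorm p (A *m x) | x in [set x | pnorm p x <= 1]].
Proof.
exists (\sum_i \sum_j `|A i j|) => _ [x /= x1 <-].
apply: le_trans (pnorm_le_sum _) _; apply: ler_sum => i _.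
rewrite mxE; apply: le_trans (ler_norm_sum _ _ _) _; apply: ler_sum => j _.
by rewrite normrM ler_piMr// (le_trans (coord_le_pnorm _ _)).
Qed.

Lemma opnorm_ge0 {m n} (A : 'M[R]_(m, n)) : 0 <= opnorm p A.
Proof.
apply: ub_le_sup; first exact: pnorm_mulmx_bounded.
by exists 0; rewrite /= ?mulmx0 ?pnorm0.
Qed.

Lemma pnorm_mulmx {m n} (A : 'M[R]_(m, n)) (x : 'cV[R]_n) :
  pnorm p (A *m x) <= opnorm p A * pnorm p x.
Proof.
have [x0|x0] := eqVneq (pnorm p x) 0.
  by rewrite x0 (pnorm_eq0 x0) mulmx0 pnorm0 mulr0.
have xgt0 : 0 < pnorm p x by rewrite lt0r x0 pnorm_ge0.
rewrite -ler_pdivrMr// mulrC -[X in X * _]gtr0_norm ?invr_gt0// -pnormZ scalemxAr.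
apply: ub_le_sup; first exact: pnorm_mulmx_bounded.
by exists ((pnorm p x)^-1 *: x) => //=; rewrite pnormZ gtr0_norm ?invr_gt0// mulVf.
Qed.

(** The reverse triangle inequality in each entry, combined with monotonicity. *)
Lemma pnorm_absvB {n} (u v : 'cV[R]_n) :
  pnorm p (absv u - absv v) <= pnorm p (u - v).
Proof. by apply: ler_pnorm => i; rewrite !mxE ler_dist_dist. Qed.

End PNorm.

(** * The Block Seidel map *)

(** The term L |T z| is implicit in T z, but its contribution to a difference
    T u - T v has norm at most ||L|| ||T u - T v|| and is absorbed in the
    left-hand side when ||L|| < 1. *)
Lemma block_seidel_contraction {R : realType} {n s : nat}
    (c : 'cV[R]_s) (b : 'cV[R]_n) (Z : 'M[R]_(s, n)) [L : 'M[R]_s]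
    (J : 'M[R]_n) (Y : 'M[R]_(n, s)) [p : \bar R] :
  strictly_lower_triangular L -> (1 <= p)%E -> opnorm p L < 1 ->
  forall u v : 'cV[R]_s,
    pnorm p (block_seidel c b Z L J Y u - block_seidel c b Z L J Y v) <=
    opnorm p (- (Z *m invmx J *m Y)) / (1 - opnorm p L) * pnorm p (u - v).
Proof.
move=> hL hp L1 u v; set T := block_seidel c b Z L J Y.
set M := - (Z *m invmx J *m Y).
have TE w : T w = c - Z *m invmx J *m b + M *m absv w + L *m absv (T w).
  have /(z_of_x_unique c Z (x_of_z b J Y w) (T w) hL) {1}-> : T w = T w by [].
  rewrite /x_of_z mulmxN mulmxA mulmxDr opprD mulmxA /M mulNmx.
  by rewrite !addrA.
have TB : T u - T v =
    M *m (absv u - absv v) + L *m (absv (T u) - absv (T v)).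
  rewrite {1}(TE u) {1}(TE v) !mulmxBr -[in X in X - _]addrA -[in X in _ - X]addrA.
  by rewrite opprD addrACA subrr add0r opprD addrACA.
rewrite mulrAC ler_pdivlMr ?subr_gt0// mulrBr mulr1 lerBlDr.
rewrite {1}TB; apply: le_trans (ler_pnormD hp _ _) _; apply: lerD.
  apply: le_trans (pnorm_mulmx hp _ _) _.
  by rewrite ler_wpM2l ?opnorm_ge0 ?pnorm_absvB.
apply: le_trans (pnorm_mulmx hp _ _) _.
by rewrite mulrC ler_wpM2r ?opnorm_ge0 ?pnorm_absvB.
Qed.

(** Solving F(x) = 0 for the linear occurrence of x, which J^-1 allows. *)
Lemma abs_normal_eq0 {R : realType} {n s : nat}
    (c : 'cV[R]_s) (b : 'cV[R]_n) (Z : 'M[R]_(s, n)) (L : 'M[R]_s)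
    [J : 'M[R]_n] (Y : 'M[R]_(n, s)) (x : 'cV[R]_n) :
  \det J != 0 ->
  abs_normal c b Z L J Y x = 0 <-> x = x_of_z b J Y (z_of_x c Z L x).
Proof.
move=> hJ; have Ju : J \in unitmx by rewrite unitmxE unitfE.
rewrite /abs_normal /x_of_z; set w := absv _.
split=> [/eqP|xE].
  rewrite addrAC addrC addr_eq0 => /eqP Jx.
  by rewrite -mulmxN -Jx mulKmx.
by rewrite {1}xE mulmxN mulKVmx// addrAC subrr.
Qed.

Theorem proposition7p1 (R : realType) (n s : nat)
  (c : 'cV[R]_s) (b : 'cV[R]_n) (Z : 'M[R]_(s, n)) (L : 'M[R]_s)
  (J : 'M[R]_n) (Y : 'M[R]_(n, s))
  (hL : strictly_lower_triangular L)
  (hJ : \det J != 0)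
  (p : \bar R) (hp : (1 <= p)%E)
  (hS : let S := L - Z *m invmx J *m Y in
        opnorm p (S - L) + opnorm p L < 1) :
  exists zs : 'cV[R]_s,
    [/\ block_seidel c b Z L J Y zs = zs,
        forall z : 'cV[R]_s, block_seidel c b Z L J Y z = z -> z = zs,
        forall z0 : 'cV[R]_s,
          (fun k : nat => iter k (block_seidel c b Z L J Y) z0) @ \oo --> zs,
        abs_normal c b Z L J Y (- (invmx J *m (b + Y *m absv zs))) = 0
      & forall x : 'cV[R]_n, abs_normal c b Z L J Y x = 0 ->
          x = - (invmx J *m (b + Y *m absv zs))].
Proof.
have L1 : opnorm p L < 1.
  by apply: le_lt_trans hS; rewrite lerDr opnorm_ge0.
have SLE : L - Z *m invmx J *m Y - L = - (Z *m invmx J *m Y).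
  by rewrite addrAC subrr add0r.
move: hS; rewrite /= SLE => {}hS.
have [|zs [Tzs zs_uniq zs_cvg]] := equiv_norm_contraction
  (mx_norm_le_pnorm hp (n := s)) (pnorm_le_mx_norm hp (n := s)) _
  (block_seidel_contraction c b Z J Y hL hp L1).
  rewrite divr_ge0 ?opnorm_ge0// ?subr_ge0 ?ltW//=.
  by rewrite ltr_pdivrMr ?subr_gt0// mul1r ltrBrDr.
exists zs; split=> //.
- by apply/abs_normal_eq0 => //; rewrite -[X in X = _]/(x_of_z b J Y zs) -{1}Tzs.
- move=> x /(abs_normal_eq0 c b Z L Y x hJ) xE.
  have <- : z_of_x c Z L x = zs by apply: zs_uniq; rewrite /block_seidel -xE.
  exact: xE.
Qed.
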